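(* Let $f\colon\mathbb{R}^d\to\mathbb{R}$ be a piecewise affine function that is bounded below, with a fixed representation $$f=\underline{f}+\overline{f},\quad\underline{f}(x)=\max_{i\in I}(a_i+\langle v_i,x\rangle),\quad\overline{f}(x)=\min_{j\in J}(b_j+\langle w_j,x\rangle),$$ $I=\{1,\dots,l\}$, $J=\{1,\dots,s\}$, $(a_i,v_i),(b_j,w_j)\in\mathbb{R}\times\mathbb{R}^d$. For $x\in\mathbb{R}^d$ and $j\in J$ let $(a_j(x),v_j(x))$ be the minimal norm point defined in the context. (1) Let $\{x_n\}$, $n\in\mathbb{N}$, be a sequence in $\mathbb{R}^d$ such that for all $n\in\mathbb{N}$ one has $f(x_{n+1})\le f(x_n)$ and $$f(x_{n+1})\le f\left(x_n+\frac{1}{a_j(x_n)}v_j(x_n)\right)\quad\text{for all } j\in J \text{ such that } a_j(x_n)<0.$$ Then $f$ attains a global minimum and there exists $n\in\mathbb{N}$ such that $x_n$ is a point of global minimum of $f$. (2) In particular, the method of codifferential descent (MCD) with $\mu=+\infty$ and $\overline{d}_\mu f(x)=\{z_j(x)\mid j\in J\}$, applied to $f$ from any starting point, finds a point of global minimum of $f$ in a finite number of steps.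
   Context: A polyhedral set is the intersection of finitely many closed halfspaces; $f$ is piecewise affine if $\mathbb{R}^d$ is a finite union of polyhedral sets with nonempty, mutually disjoint interiors on each of which $f$ is affine; every such function has a representation of the form displayed in the claim. $\mathbb{R}\times\mathbb{R}^d$ has the norm $\|(a,v)\|^2=a^2+\|v\|^2$; $\operatorname{co}$ is the convex hull. For $x\in\mathbb{R}^d$ and $j\in J$: $$\underline{d}f(x)=\operatorname{co}\{(a_i-\underline{f}(x)+\langle v_i,x\rangle,\,v_i)\mid i\in I\},\qquad z_j(x)=(b_j-\overline{f}(x)+\langle w_j,x\rangle,\,w_j),$$ and $(a_j(x),v_j(x))$ is the unique minimizer of $\|(a,v)\|^2$ over $(a,v)\in\underline{d}f(x)+z_j(x)$. **MCD** (with $\mu=+\infty$, $\overline{d}_\mu f(x)=\{z_j(x)\mid j\in J\}$). Choose $x_0\in\mathbb{R}^d$. For $n=0,1,2,\dots$: for every $j\in J$ compute $(a_j(x_n),v_j(x_n))$ and a solution $\alpha_n(j)\ge0$ of the problem of minimizing $\alpha\mapsto f(x_n-\alpha v_j(x_n))$ over $\alpha\ge0$; choose $j_n\in J$ minimizing $f(x_n-\alpha_n(j)v_j(x_n))$ over $j\in J$; set $x_{n+1}=x_n-\alpha_n(j_n)v_{j_n}(x_n)$. ''Finds a point of global minimum in a finite number of steps'' means that $x_n$ is a point of global minimum of $f$ for some $n$. *)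

(* Defs.v *)
From HB Require Import structures.
From mathcomp Require Import all_boot all_order all_algebra.
From mathcomp Require Import all_classical all_reals all_analysis.

Set Implicit Arguments.
Unset Strict Implicit.
Unset Printing Implicit Defensive.

Import Order.TTheory GRing.Theory Num.Theory.
Import numFieldNormedType.Exports.

Local Open Scope classical_set_scope.
Local Open Scope ring_scope.

Section Geometry.
Context {R : realType}.

Definition dotv {d : nat} (u v : 'rV[R]_d) : R := \sum_(k < d) u 0 k * v 0 k.

Definition halfspace {d : nat} (H : set 'rV[R]_d) : Prop :=
  exists (u : 'rV[R]_d) (c : R), u != 0 /\ H = [set x | dotv u x <= c].

(* For m = 0 the intersection is the whole space. *)
Definition polyhedral_set {d : nat} (P : set 'rV[R]_d) : Prop :=
  exists (m : nat) (H : 'I_m -> set 'rV[R]_d),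
    (forall k, halfspace (H k)) /\ P = \bigcap_(k in [set: 'I_m]) H k.

Definition affine_on {d : nat} (P : set 'rV[R]_d) (f : 'rV[R]_d -> R) : Prop :=
  exists (c : R) (u : 'rV[R]_d), forall x, P x -> f x = c + dotv u x.

Definition piecewise_affine {d : nat} (f : 'rV[R]_d -> R) : Prop :=
  exists (m : nat) (P : 'I_m -> set 'rV[R]_d),
    [/\ forall k, polyhedral_set (P k),
        forall k, (interior (P k)) !=set0,
        trivIset [set: 'I_m] (fun k => interior (P k)),
        \bigcup_(k in [set: 'I_m]) P k = [set: 'rV[R]_d]
      & forall k, affine_on (P k) f].

Definition is_global_min {T : Type} (f : T -> R) (x : T) : Prop :=
  forall y, f x <= f y.

(* R^o is R seen as a module over itself, so that R^o * 'rV[R]_d is the real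
   vector space R x R^d. *)
Definition sqnorm {d : nat} (p : R^o * 'rV[R]_d) : R :=
  p.1 ^+ 2 + dotv p.2 p.2.

Definition co {V : lmodType R} (A : set V) : set V :=
  smallest (fun C : set (convex_lmodType V) => convex_set C) A.

Definition minimizes_sqnorm {d : nat} (D : set (R^o * 'rV[R]_d))
    (p : R^o * 'rV[R]_d) : Prop :=
  D p /\ forall q, D q -> sqnorm p <= sqnorm q.

(* The default value 0 is irrelevant when D has a point of minimal norm, e.g.
   when D is nonempty, closed and convex. *)
Definition min_norm_point {d : nat} (D : set (R^o * 'rV[R]_d)) :
    R^o * 'rV[R]_d :=
  xget 0 [set p | minimizes_sqnorm D p].

End Geometry.

Section CodifferentialDescent.
Context {R : realType} {d l s : nat}.
(* The index sets are nonempty: I = 'I_l.+1 and J = 'I_s.+1. *)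
Variables (a : 'I_l.+1 -> R) (v : 'I_l.+1 -> 'rV[R]_d).
Variables (b : 'I_s.+1 -> R) (w : 'I_s.+1 -> 'rV[R]_d).
Implicit Types (x : 'rV[R]_d) (j : 'I_s.+1).

(* The unit of the iterated maximum is the term of index 0, hence harmless;
   likewise for the minimum. *)
Definition f_lower x : R :=
  \big[Num.max/(a ord0 + dotv (v ord0) x)]_(i < l.+1) (a i + dotv (v i) x).

Definition f_upper x : R :=
  \big[Num.min/(b ord0 + dotv (w ord0) x)]_(j < s.+1) (b j + dotv (w j) x).

Definition hypodiff x : set (R^o * 'rV[R]_d) :=
  co [set (a i - f_lower x + dotv (v i) x : R^o, v i) | i in [set: 'I_l.+1]].

Definition zpt j x : R^o * 'rV[R]_d := (b j - f_upper x + dotv (w j) x, w j).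

(* The point (a_j(x), v_j(x)). *)
Definition descent_pt j x : R^o * 'rV[R]_d :=
  min_norm_point [set p + zpt j x | p in hypodiff x].

Definition descent_a j x : R := (descent_pt j x).1.
Definition descent_v j x : 'rV[R]_d := (descent_pt j x).2.

Definition line_search_solution (f : 'rV[R]_d -> R) x (u : 'rV[R]_d) (t : R) :
    Prop :=
  0 <= t /\ forall t', 0 <= t' -> f (x - t *: u) <= f (x - t' *: u).

(* A run of the method on f from x0, all choices of step sizes and of indices
   being arbitrary among the optimal ones. *)
Definition MCD_run (f : 'rV[R]_d -> R) (x0 : 'rV[R]_d)
    (x : nat -> 'rV[R]_d) (alpha : nat -> 'I_s.+1 -> R)
    (jn : nat -> 'I_s.+1) : Prop :=
  x 0%N = x0 /\
  forall n : nat,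
    [/\ forall j, line_search_solution f (x n) (descent_v j (x n)) (alpha n j),
        forall j, f (x n - alpha n (jn n) *: descent_v (jn n) (x n))
                    <= f (x n - alpha n j *: descent_v j (x n))
      & x n.+1 = x n - alpha n (jn n) *: descent_v (jn n) (x n)].

End CodifferentialDescent.

(* Main.v *)
Require Import Defs.
From mathcomp Require Import all_boot all_order all_algebra.
From mathcomp Require Import all_classical all_reals all_analysis.
From mathcomp Require Import ring lra.

Import Order.TTheory GRing.Theory Num.Theory.
Import numFieldNormedType.Exports.

Local Open Scope classical_set_scope.
Local Open Scope ring_scope.

(** The function f is the lower envelope over j of the convex branches
      g_j(y) = max_i (c_i + <q_i, y>),   c_i = a_i + b_j,  q_i = v_i + w_j,
    and the set whose nearest point to 0 is (a_j(x), v_j(x)) is the convex hull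
    of the points u_i = (c_i + <q_i, x> - f(x), q_i).  Write (al, v) for this
    nearest point and r = al^2 + |v|^2.  It satisfies <(al, v), u_i> >= r for all
    i, with equality for the i in the support A of a convex combination that
    represents it ([nearest_point_spec]).  Fix j such that g_j has the least
    infimum among the branches ([lowest_branch]).

    - If g_j takes a value below f(x), in particular if x is not a global
      minimum of f, then al < 0: otherwise the variational inequality gives a
      direction along which the bounded below function g_j tends to -oo
      ([nearest_fst_lt0]).
    - Let al < 0.  Dividing the variational inequality by al shows that the step
      x' = x + v / al satisfies g_j(x') <= f(x) + r / al ([nearest_step_le]).
    - If 0 is a convex combination of the q_i with i in A, with weights mu, then
      pairing (al, v) with the corresponding combination of the u_i gives
      f(x) + r / al = C, where C is the sum of the mu_i c_i.  As C is also the sum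
      of the mu_i (c_i + <q_i, y>) for every y, it is a lower bound of g_j.  Hence
      g_j(x') <= C <= inf g_j, and x' is a global minimum of f.
    - Otherwise |v|^2 is at least the squared distance from 0 to the hull of the
      q_i with i in A.  This distance is positive, and A ranges over a finite
      collection, so |v|^2 >= e for some e > 0 independent of x ([face_gap]).
      Then r / al <= - min(1, e).

    So each iteration starts at a global minimum, or reaches one, or decreases f
    by a fixed amount ([descent_drop]); as f is bounded below, the last case
    cannot persist.  A run of MCD satisfies the required inequality because its
    line search considers the step size - 1 / a_j(x_n).  Runs exist because on a
    ray f is continuous, affine from some point on, and bounded below, hence
    attains its minimum ([line_search_exists]). *)

(** * Inner products *)

Section InnerProducts.
Context {R : realType} {d : nat}.
Implicit Types (x y z : 'rV[R]_d) (p q r : R^o * 'rV[R]_d).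

Lemma dotvC x y : dotv x y = dotv y x.
Proof. by apply: eq_bigr => k _; rewrite mulrC. Qed.

Lemma dotvDr x y z : dotv x (y + z) = dotv x y + dotv x z.
Proof.
by rewrite -big_split; apply: eq_bigr => k _; rewrite mxE mulrDr.
Qed.

Lemma dotvDl x y z : dotv (x + y) z = dotv x z + dotv y z.
Proof. by rewrite dotvC dotvDr !(dotvC z). Qed.

Lemma dotvZr k x y : dotv x (k *: y) = k * dotv x y.
Proof. by rewrite mulr_sumr; apply: eq_bigr => i _; rewrite mxE mulrCA. Qed.

Lemma dotvZl k x y : dotv (k *: x) y = k * dotv x y.
Proof. by rewrite dotvC dotvZr dotvC. Qed.

Lemma dotv0r x : dotv x 0 = 0.
Proof. by rewrite -(scale0r 0) dotvZr mul0r. Qed.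

Lemma dotvBr x y z : dotv x (y - z) = dotv x y - dotv x z.
Proof. by rewrite -scaleN1r dotvDr dotvZr mulN1r. Qed.

Lemma dotv_ge0 x : 0 <= dotv x x.
Proof. by apply: sumr_ge0 => k _; rewrite -expr2 sqr_ge0. Qed.

Lemma dotv_eq0 x : (dotv x x == 0) = (x == 0).
Proof.
apply/idP/eqP => [|->]; last by rewrite dotv0r.
rewrite psumr_eq0 => [/allP x0|k _]; last by rewrite -expr2 sqr_ge0.
apply/rowP => k; rewrite mxE; apply/eqP.
by have := x0 k (mem_index_enum k); rewrite mulf_eq0 orbb.
Qed.

Definition dotp p q : R := p.1 * q.1 + dotv p.2 q.2.

Lemma sqnormE p : sqnorm p = dotp p p.
Proof. by rewrite /sqnorm expr2. Qed.

Lemma dotpC p q : dotp p q = dotp q p.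
Proof. by rewrite /dotp mulrC dotvC. Qed.

Lemma dotpDr p q r : dotp p (q + r) = dotp p q + dotp p r.
Proof. by rewrite /dotp/= mulrDr dotvDr addrACA. Qed.

Lemma dotpZr k p q : dotp p (k *: q) = k * dotp p q.
Proof. by rewrite /dotp/= dotvZr mulrDr (mulrCA p.1). Qed.

Lemma dotpDl p q r : dotp (p + q) r = dotp p r + dotp q r.
Proof. by rewrite dotpC dotpDr !(dotpC r). Qed.

Lemma dotpZl k p q : dotp (k *: p) q = k * dotp p q.
Proof. by rewrite dotpC dotpZr dotpC. Qed.

Lemma sqnorm_ge0 p : 0 <= sqnorm p.
Proof. by rewrite addr_ge0 ?sqr_ge0 ?dotv_ge0. Qed.

End InnerProducts.

(** * Convex hulls of finite families *)

Section ConvexCombinations.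
Context {R : realType}.

(** The face of the standard simplex spanned by the vertices of index in [A]. Row
    vectors are used so that the topology of ['rV[R]_n] gives its compactness. *)
Definition weights {n} (A : {set 'I_n}) : set 'rV[R]_n :=
  [set t | [/\ forall i, 0 <= t 0 i, \sum_i t 0 i = 1
             & forall i, i \notin A -> t 0 i = 0]].

Definition comb {V : lmodType R} {n} (u : 'I_n -> V) (t : 'rV[R]_n) : V :=
  \sum_i t 0 i *: u i.

Lemma comb_delta {V : lmodType R} {n} (u : 'I_n -> V) i :
  comb u (delta_mx 0 i) = u i.
Proof.
rewrite /comb (bigD1 i)//= mxE !eqxx scale1r big1 ?addr0// => j /negPf ji.
by rewrite mxE ji andbF scale0r.
Qed.

Lemma weights_delta {n} (A : {set 'I_n}) i : i \in A -> weights A (delta_mx 0 i).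
Proof.
move=> iA; split => [j||j jA]; first by rewrite mxE ler0n.
- rewrite (bigD1 i)//= mxE !eqxx big1 ?addr0// => j /negPf ji.
  by rewrite mxE ji andbF.
- have /negPf ji : j != i by apply: contraNneq jA => ->.
  by rewrite mxE ji andbF.
Qed.

Lemma weights_segment {n} (A : {set 'I_n}) (k : R) t t' :
  0 <= k -> k <= 1 -> weights A t -> weights A t' ->
  weights A (k *: t + (1 - k) *: t').
Proof.
move=> k0 k1 [t0 t1 tA] [t'0 t'1 t'A]; split => [i||i iA].
- by rewrite !mxE addr_ge0 ?mulr_ge0 ?subr_ge0.
- under eq_bigr => i _ do rewrite !mxE.
  by rewrite big_split/= -!mulr_sumr t1 t'1 !mulr1 subrKC.
- by rewrite !mxE tA// t'A// !mulr0 addr0.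
Qed.

Lemma combD {V : lmodType R} {n} (u : 'I_n -> V) t t' :
  comb u (t + t') = comb u t + comb u t'.
Proof.
by rewrite -big_split; apply: eq_bigr => i _; rewrite mxE scalerDl.
Qed.

Lemma combZ {V : lmodType R} {n} (u : 'I_n -> V) k t :
  comb u (k *: t) = k *: comb u t.
Proof.
by rewrite scaler_sumr; apply: eq_bigr => i _; rewrite mxE scalerA.
Qed.

Lemma comb_shift {V : lmodType R} {n} (A : {set 'I_n}) (u : 'I_n -> V) z t :
  weights A t -> comb (fun i => u i + z) t = comb u t + z.
Proof.
move=> [_ t1 _]; rewrite /comb; under eq_bigr => i _ do rewrite scalerDr.
by rewrite big_split/= -scaler_suml t1 scale1r.
Qed.

Lemma comb_fst {d n} (u : 'I_n -> R^o * 'rV[R]_d) t :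
  (comb u t).1 = \sum_i t 0 i * (u i).1.
Proof. exact: (big_morph (fun p : R^o * _ => p.1)). Qed.

Lemma comb_snd {d n} (u : 'I_n -> R^o * 'rV[R]_d) t :
  (comb u t).2 = comb (fun i => (u i).2) t.
Proof. exact: (big_morph (fun p : R^o * _ => p.2)). Qed.

Lemma dotv_comb {d n} x (u : 'I_n -> 'rV[R]_d) t :
  dotv x (comb u t) = \sum_i t 0 i * dotv x (u i).
Proof.
rewrite /comb (big_morph (dotv x) (dotvDr x) (dotv0r x)).
by apply: eq_bigr => i _; rewrite dotvZr.
Qed.

Lemma dotp_comb {d n} p (u : 'I_n -> R^o * 'rV[R]_d) t :
  dotp p (comb u t) = \sum_i t 0 i * dotp p (u i).
Proof.
rewrite /dotp comb_fst comb_snd dotv_comb mulr_sumr -big_split.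
by apply: eq_bigr => i _ /=; rewrite mulrDr mulrCA.
Qed.

(** By induction on the index sequence, every partial sum of the combination is
    its total weight times a point of the convex set; this form needs no
    normalization of the partial weights. *)
Lemma convex_set_comb {V : lmodType R} {n} (C : set (convex_lmodType V))
    (u : 'I_n -> V) t :
  convex_set C -> (forall i, C (u i)) -> weights [set: 'I_n]%SET t ->
  C (comb u t).
Proof.
move=> convC Cu [t0 t1 _].
have [i0] : exists i : 'I_n, True.
  case: n t u t1 {t0 Cu} => [t u|n t u _]; last by exists ord0.
  by rewrite big_ord0 => /eqP; rewrite eq_sym oner_eq0.
move=> _.
suff [y Cy] : exists2 y, C y &
    comb u t = (\sum_i t 0 i) *: (y : V) by rewrite t1 scale1r => ->.
rewrite /comb; elim: (index_enum 'I_n) => [|i r [y Cy IH]].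
  by exists (u i0) => //; rewrite !big_nil scale0r.
rewrite !big_cons IH; set S := \sum_(j <- r) t 0 j.
have S0 : 0 <= S by apply: sumr_ge0 => j _.
have [tS0|tS0] := eqVneq (t 0 i + S) 0.
  exists (u i) => //.
  move: tS0 => /eqP; rewrite paddr_eq0 // => /andP[/eqP -> /eqP ->].
  by rewrite addr0 !scale0r addr0.
have tSgt0 : 0 < t 0 i + S by rewrite lt_neqAle eq_sym tS0 addr_ge0.
have k0 : 0 <= t 0 i / (t 0 i + S) by rewrite divr_ge0 ?addr_ge0.
have k1 : t 0 i / (t 0 i + S) <= 1 by rewrite ler_pdivrMr// mul1r lerDl.
have := convC (u i) y (Itv01 k0 k1) (mem_set (Cu i)) (mem_set Cy).
rewrite inE => Cz; eexists; first exact: Cz.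
rewrite [in RHS]/conv/= -/(1 - _) scalerDr !scalerA mulrBr mulr1 mulrCA divff// mulr1.
by rewrite addrAC subrr add0r.
Qed.

Lemma co_range {V : lmodType R} {n} (u : 'I_n -> V) :
  co [set u i | i in [set: 'I_n]] =
  [set comb u t | t in weights [set: 'I_n]%SET].
Proof.
apply/seteqP; split => [|_ [t wt <-] C [convC uC]]; last first.
  by apply: convex_set_comb => // i; apply: uC; exists i.
apply: smallest_sub => [x y k|_ [i _ <-]].
  rewrite !inE => -[t wt <-] [t' wt' <-].
  exists (k%:num *: t + (1 - k%:num) *: t'); first exact: weights_segment.
  by rewrite combD !combZ.
by exists (delta_mx 0 i); [exact: weights_delta|rewrite comb_delta].
Qed.

(** A finite system of non-strict inequalities and equations between coordinates
    that lie in [0, 1]. *)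
Lemma weights_compact {n} (A : {set 'I_n}) : compact (weights A).
Proof.
apply: bounded_closed_compact.
  exists 1; split => // M M1 t [t0 t1 _] /=.
  rewrite [leLHS]mx_normrE; apply/bigmax_leP; split.
    by rewrite (le_trans _ (ltW M1)).
  move=> [i j] _ /=; rewrite (ord1 i) ger0_norm// (le_trans _ (ltW M1))//.
  by rewrite -t1 (bigD1 j)//= lerDl sumr_ge0.
have ccoord i : continuous (fun t : 'rV[R]_n => t 0 i).
  exact: coord_continuous.
have -> : weights A =
    (\bigcap_i [set t : 'rV[R]_n | 0 <= t 0 i]) `&`
    ([set t : 'rV[R]_n | \sum_i t 0 i = 1] `&`
    \bigcap_(i in [set i | i \notin A]) [set t : 'rV[R]_n | t 0 i = 0]).
  apply/seteqP; split => [t [t0 t1 tA]|t [t0 [t1 tA]]].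
  - by split => [i _|]; [exact: t0|split => // i /tA].
  - by split => [i||i iA]; [exact: t0|exact: t1|exact: tA].
apply: closedI; first by apply: closed_bigI => i _;
  apply: (@closed_comp _ _ (fun t : 'rV[R]_n => t 0 i) [set y | 0 <= y]);
  [move=> t _; exact: ccoord|exact: closed_ge].
apply: closedI.
  apply: (@closed_comp _ _ (fun t : 'rV[R]_n => \sum_i t 0 i) [set y | y = 1]).
    by move=> t _; apply: continuous_big => // x; exact: add_continuous.
  exact: closed_eq.
apply: closed_bigI => i _.
apply: (@closed_comp _ _ (fun t : 'rV[R]_n => t 0 i) [set y | y = 0]).
  by move=> t _; exact: ccoord.
exact: closed_eq.
Qed.

(** The squared norm is a polynomial in the weights, and a face is compact. *)
Lemma weights_argmin {d n} (A : {set 'I_n}) (u : 'I_n -> R^o * 'rV[R]_d) :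
  A != finset.set0 ->
  exists2 t, weights A t &
    forall t', weights A t' -> sqnorm (comb u t) <= sqnorm (comb u t').
Proof.
move=> /set0Pn[i iA].
have cF (T : topologicalType) (c : 'I_n -> T -> R) :
    (forall j, continuous (c j)) ->
    continuous (fun t => sqnorm (\sum_j c j t *: u j)).
  move=> cc.
  have clin (F : 'I_n -> R) : continuous (fun t => \sum_j c j t * F j).
    apply: continuous_big => [x|j _ t]; first exact: add_continuous.
    by apply: continuousM; [exact: cc|exact: cst_continuous].
  have csqr (F : 'I_n -> R) :
      continuous (fun t => (\sum_j c j t * F j) * (\sum_j c j t * F j)).
    by move=> t; apply: continuousM; exact: clin.
  have -> : (fun t => sqnorm (\sum_j c j t *: u j)) =
      (fun t => (\sum_j c j t * (u j).1) * (\sum_j c j t * (u j).1) +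
        \sum_k (\sum_j c j t * (u j).2 0 k) * (\sum_j c j t * (u j).2 0 k)).
    apply/funext => t; rewrite sqnormE /dotp.
    rewrite (big_morph (fun p : R^o * _ => p.1) (id1 := 0) (op1 := +%R))//.
    rewrite (big_morph (fun p : R^o * _ => p.2) (id1 := 0) (op1 := +%R))//.
    congr (_ + _); apply: eq_bigr => k _; rewrite summxE.
    by congr (_ * _); apply: eq_bigr => j _; rewrite mxE.
  move=> t; apply: cvgD; first exact: csqr.
  apply: continuous_big => [x|k _]; first exact: add_continuous.
  exact: csqr.
have [|||t] := @EVT_min_rV R n (fun t => sqnorm (comb u t)) (weights A).
- by exists (delta_mx 0 i); exact: weights_delta.
- exact: weights_compact.
- apply: continuous_subspaceT.
  by apply: (cF 'rV[R]_n (fun j t => t 0 j)) => j; exact: coord_continuous.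
- by rewrite inE => wt tmin; exists t => // t' wt'; apply: tmin; rewrite inE.
Qed.

End ConvexCombinations.

(** * The point of least norm of a polytope *)

Section NearestPoint.
Context {R : realType} {d n : nat}.

(** The variational inequality holds because moving from [p] towards [u i] does
    not decrease the norm.  Its average with the weights of [p] is an equality,
    so it is tight at every index of positive weight. *)
Lemma nearest_point_spec (u : 'I_n.+1 -> R^o * 'rV[R]_d) :
  let p := min_norm_point [set comb u t | t in weights [set: 'I_n.+1]%SET] in
  exists (A : {set 'I_n.+1}) (t : 'rV[R]_n.+1),
    [/\ weights A t, p = comb u t, forall i, sqnorm p <= dotp p (u i)
      & forall i, i \in A -> dotp p (u i) = sqnorm p].
Proof.
move=> p.
have [[t wt pE] pmin] : minimizes_sqnorm
    [set comb u t | t in weights [set: 'I_n.+1]%SET] p.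
  apply: xgetPex.
  have [|t wt tmin] := @weights_argmin R d n.+1 [set: 'I_n.+1]%SET u.
    by apply/set0Pn; exists ord0; rewrite inE.
  exists (comb u t); split; first by exists t.
  by move=> _ [t' wt' <-]; exact: tmin.
have pu i : sqnorm p <= dotp p (u i).
  rewrite leNgt; apply/negP => lt_pu.
  have seg k : 0 <= k -> k <= 1 ->
      sqnorm p <= sqnorm (k *: u i + (1 - k) *: p).
    move=> k0 k1; apply: pmin.
    exists (k *: delta_mx 0 i + (1 - k) *: t).
      by apply: weights_segment => //; apply: weights_delta; rewrite inE.
    by rewrite combD !combZ comb_delta pE.
  have N0 : 0 <= sqnorm (u i + (-1) *: p) := sqnorm_ge0 _.
  move: N0 seg lt_pu.
  under [X in _ -> X -> _]eq_forall => k.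
    rewrite !sqnormE !(dotpDr, dotpDl, dotpZr, dotpZl) (dotpC (u i) p); over.
  rewrite !sqnormE !(dotpDr, dotpDl, dotpZr, dotpZl) (dotpC (u i) p).
  set a := dotp p p; set b := dotp p (u i); set c := dotp (u i) (u i).
  move=> N0 seg ltba.
  (* With N = |u_i - p|^2, the squared norm of k u_i + (1 - k) p is
     a - 2 k (a - b) + k^2 N, with minimizer (a - b) / N if N > 0; the larger
     denominator a - b + N is positive and keeps k in ]0, 1]. *)
  pose N := c - 2 * b + a; pose k := (a - b) / (a - b + N).
  have N_ge0 : 0 <= N by rewrite /N; lra.
  have D0 : 0 < a - b + N by lra.
  have k0 : 0 < k by rewrite divr_gt0// subr_gt0.
  have k1 : k <= 1 by rewrite ler_pdivrMr// mul1r lerDl.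
  have kD : k * (a - b + N) = a - b by rewrite divfK ?gt_eqF.
  have := seg k (ltW k0) k1.
  have -> : k * (k * c) + k * ((1 - k) * b) +
      ((1 - k) * (k * b) + (1 - k) * ((1 - k) * a)) =
      a - k * (2 * (a - b) - k * N) by rewrite /N; ring.
  have : 0 < k * (2 * (a - b) - k * N).
    by rewrite pmulr_rgt0//; move: kD; rewrite mulrDr; nra.
  by lra.
exists [set i | t 0 i != 0]%SET, t.
have [t0 t1 _] := wt.
split => //.
- by split => // i; rewrite inE negbK => /eqP.
- move=> i; rewrite inE => ti.
  have slack j : 0 <= t 0 j * (dotp p (u j) - sqnorm p).
    by rewrite mulr_ge0// subr_ge0.
  have /psumr_eq0P : \sum_j t 0 j * (dotp p (u j) - sqnorm p) = 0.
    under eq_bigr => j _ do rewrite mulrBr.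
    by rewrite sumrB -dotp_comb -mulr_suml t1 mul1r pE sqnormE subrr.
  move=> /(_ (fun j _ => slack j) i isT)/eqP.
  by rewrite mulf_eq0 (negPf ti)/= subr_eq0 => /eqP.
Qed.

(** Each face of the hull of the [q i] either contains 0 or stays away from it;
    there are finitely many faces.  The bound is uniform in the constant terms of
    the affine functions and in the base point, on which only the first
    coordinates of the points [hypopoint] defined below depend. *)
Lemma face_gap (q : 'I_n.+1 -> 'rV[R]_d) :
  exists2 e : R, 0 < e & forall A : {set 'I_n.+1},
    (exists2 t, weights A t & comb q t = 0) \/
    (forall t, weights A t -> e <= dotv (comb q t) (comb q t)).
Proof.
have gapA (A : {set 'I_n.+1}) : exists e : R, 0 < e /\
    ((exists2 t, weights A t & comb q t = 0) \/
     (forall t, weights A t -> e <= dotv (comb q t) (comb q t))).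
  have [->|A0] := eqVneq A finset.set0.
    exists 1; split => //; right => t [_ t1 tA]; exfalso; move: t1.
    rewrite big1 => [/eqP|i _]; first by rewrite eq_sym oner_eq0.
    by rewrite tA ?inE.
  have [t wt tmin] := weights_argmin A (fun i => (0, q i) : R^o * 'rV[R]_d) A0.
  have sq t' : sqnorm (comb (fun i => (0, q i) : R^o * 'rV[R]_d) t') =
      dotv (comb q t') (comb q t').
    rewrite /sqnorm comb_fst comb_snd big1 ?expr0n ?add0r// => i _.
    by rewrite mulr0.
  have [q0|q0] := eqVneq (comb q t) 0.
    by exists 1; split => //; left; exists t.
  exists (dotv (comb q t) (comb q t)); split.
    by rewrite lt_neqAle eq_sym dotv_eq0 q0 dotv_ge0.
  by right => t' wt'; rewrite -!sq; exact: tmin.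
have [e eP] := choice gapA.
exists (\big[Num.min/1]_A e A).
  by apply: lt_bigmin => // A _; have [] := eP A.
move=> A; have [_ [?|eA]] := eP A; [by left|right => t wt].
by apply: le_trans (eA t wt); exact: bigmin_le.
Qed.

End NearestPoint.

(** * One descent step on a maximum of affine functions *)

Section MaxOfAffine.
Context {R : realType} {d n : nat}.
Context (c : 'I_n.+1 -> R) (q : 'I_n.+1 -> 'rV[R]_d).

Definition piece (i : 'I_n.+1) (y : 'rV[R]_d) : R := c i + dotv (q i) y.

(** The maximum of the pieces at [y] exceeds [m] by the maximum over [i] of the
    pairings of [hypopoint m x i] with (1, y - x). *)
Definition hypopoint (m : R) (x : 'rV[R]_d) (i : 'I_n.+1) : R^o * 'rV[R]_d :=
  (piece i x - m, q i).

Definition nearest (m : R) (x : 'rV[R]_d) : R^o * 'rV[R]_d :=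
  min_norm_point [set comb (hypopoint m x) t | t in weights [set: 'I_n.+1]%SET].

Lemma piece_shift i x y : piece i (x + y) = piece i x + dotv (q i) y.
Proof. by rewrite /piece dotvDr addrA. Qed.

(** Let (al, v) be the nearest point, and suppose that al >= 0.  As
    al (m - piece i y) >= 0, the variational inequality shows that
    z = v - al (y - x) has <q_i, z> >= r for all i, where r is the squared norm of
    (al, v).  Moreover r > 0, since pairing with (1, y - x) is negative on the
    hull.  Hence all pieces tend to -oo along -z. *)
Lemma nearest_fst_lt0 m L x y :
  (forall z, exists i, L <= piece i z) -> (forall i, piece i y < m) ->
  (nearest m x).1 < 0.
Proof.
move=> bounded ym.
have := nearest_point_spec (hypopoint m x).
rewrite -/(nearest m x); case: (nearest m x) => /= al v [A [t [wt pE pu _]]].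
rewrite ltNge; apply/negP => al0.
have [t0 t1 _] := wt.
set r := sqnorm _ in pu.
have r0 : 0 < r.
  rewrite lt_neqAle sqnorm_ge0 andbT eq_sym; apply/eqP => r0.
  have /andP[al_0 v0] : (al == 0) && (v == 0).
    move/eqP: r0; rewrite /r /sqnorm/= paddr_eq0 ?sqr_ge0 ?dotv_ge0//.
    by rewrite sqrf_eq0 dotv_eq0.
  (* If the nearest point is 0, its pairing with (1, y - x), a weighted mean of
     the negative numbers piece i y - m, vanishes. *)
  have /psumr_eq0P tm0 : \sum_i t 0 i * (m - piece i y) = 0.
    have := dotp_comb ((-1, x - y) : R^o * 'rV[R]_d) (hypopoint m x) t.
    rewrite -pE /dotp/= (eqP al_0) (eqP v0) dotv0r mulr0 addr0 => sum0.
    rewrite [RHS]sum0.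
    apply: eq_bigr => i _; rewrite -[y in piece i y](subrKC x) piece_shift.
    by rewrite /= (dotvC (x - y)) !dotvBr; ring.
  have tm_ge0 i : true -> 0 <= t 0 i * (m - piece i y).
    by move=> _; rewrite mulr_ge0// subr_ge0 ltW.
  have ti i : t 0 i = 0.
    have /eqP := tm0 tm_ge0 i isT.
    by rewrite mulf_eq0 subr_eq0 (gt_eqF (ym i)) orbF => /eqP.
  by move/eqP: t1; rewrite big1 ?(eq_sym 0) ?oner_eq0.
pose z := v - al *: (y - x).
have qz i : r <= dotv (q i) z.
  have := pu i; rewrite /dotp /hypopoint/=.
  have : 0 <= al * (m - piece i y) by rewrite mulr_ge0// subr_ge0 ltW.
  rewrite -[y in piece i y](subrKC x) piece_shift.
  by rewrite /z (dotvBr _ v) dotvZr (dotvC v); lra.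
(* The sum bounds the excess over L of every piece at x, and the summand 1
   makes the inequality strict. *)
pose T := (\sum_i `|piece i x - L|) / r + 1.
have [i] := bounded (x - T *: z).
rewrite leNgt => /negP; apply.
rewrite -scaleNr piece_shift dotvZr mulNr.
have T0 : 0 <= T by rewrite addr_ge0// divr_ge0 ?sumr_ge0// ltW.
have : T * r <= T * dotv (q i) z by rewrite ler_wpM2l.
have -> : T * r = \sum_i `|piece i x - L| + r.
  by rewrite mulrDl mul1r divfK ?gt_eqF.
have : piece i x - L <= \sum_i `|piece i x - L|.
  rewrite (le_trans (ler_norm _))// (bigD1 i)//= lerDl.
  by apply: sumr_ge0.
by lra.
Qed.

Lemma nearest_step_le m x i : (nearest m x).1 < 0 ->
  piece i (x + (1 / (nearest m x).1) *: (nearest m x).2)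
    <= m + sqnorm (nearest m x) / (nearest m x).1.
Proof.
move=> al0; have [_ [_ [_ _ /(_ i) pu _]]] := nearest_point_spec (hypopoint m x).
move: pu; rewrite -/(nearest m x) /dotp /hypopoint/=.
move: al0; set al := (nearest m x).1; set v := (nearest m x).2.
set r := sqnorm _ => al0 pu.
rewrite piece_shift dotvZr div1r mulrC -lerBlDl addrAC.
rewrite ler_ndivlMr// mulrDl divfK ?lt_eqF// dotvC.
by rewrite mulrC.
Qed.

(** Let A be the support of the nearest point (al, v).  If 0 is a convex
    combination of the [q i] with i in A, the bound [m + sqnorm / al] of the
    previous lemma is the same combination of the [c i], hence of the pieces at
    any point, and so a lower bound of their maximum: the step minimizes that
    maximum.  Otherwise [|v|^2] is bounded away from 0, and then so is the
    guaranteed decrease (al^2 + |v|^2) / |al|. *)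
Lemma nearest_step_dichotomy : exists2 e : R, 0 < e &
  forall m x, (nearest m x).1 < 0 ->
    let x' := x + (1 / (nearest m x).1) *: (nearest m x).2 in
    (forall i, piece i x' <= m - e) \/
    (forall i y g, (forall k, piece k y <= g) -> piece i x' <= g).
Proof.
have [e e0 gap] := face_gap q.
exists (Num.min 1 e); first by rewrite lt_min ltr01.
move=> m x al0 x'.
have := nearest_point_spec (hypopoint m x); rewrite -/(nearest m x).
move=> [A [t [wt pE pu pA]]].
have step i := nearest_step_le m x i al0.
have [[s ws qs0]|gapA] := gap A.
  right => i y g yg; apply: (le_trans (step i)).
  have [s0 s1 sA] := ws.
  have avg z : \sum_k s 0 k * piece k z = \sum_k s 0 k * c k.
    under eq_bigr => k _ do rewrite mulrDr dotvC.
    by rewrite big_split/= -dotv_comb qs0 dotv0r addr0.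
  have -> : sqnorm (nearest m x) = (nearest m x).1 * (\sum_k s 0 k * c k - m).
    have := dotp_comb (nearest m x) (hypopoint m x) s.
    rewrite [RHS](_ : _ = \sum_k s 0 k * sqnorm (nearest m x)); last first.
      apply: eq_bigr => k _; have [/pA->//|/sA->] := boolP (k \in A).
      by rewrite !mul0r.
    rewrite -mulr_suml s1 mul1r /dotp comb_snd qs0 dotv0r addr0 => <-.
    rewrite comb_fst /=; under eq_bigr => k _ do rewrite mulrBr.
    by rewrite sumrB -mulr_suml s1 mul1r avg.
  rewrite mulrAC divff ?lt_eqF// mul1r subrKC -(avg y).
  rewrite -[leRHS]mul1r -s1 mulr_suml; apply: ler_sum => k _.
  exact: ler_wpM2l.
left => i; apply: (le_trans (step i)); rewrite lerD2l.
rewrite ler_ndivrMr// /sqnorm mulNr -mulrN.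
have : e <= dotv (nearest m x).2 (nearest m x).2.
  by rewrite pE comb_snd; exact: gapA.
move: al0; set al := (nearest m x).1; set vv := dotv _ _ => al0 evv.
(* For |al| >= 1 the term al^2 already yields the decrease 1; for |al| < 1 the
   term |v|^2 yields e. *)
have [al1|al1] := leP 1 (- al).
  have : Num.min 1 e * - al <= 1 * - al.
    by rewrite ler_wpM2r ?ge_min ?lexx//; lra.
  by nra.
have : Num.min 1 e * - al <= e * - al.
  by rewrite ler_wpM2r ?ge_min ?lexx ?orbT//; lra.
by nra.
Qed.

End MaxOfAffine.

(** * The branches of f *)

Section Representation.
Context {R : realType} {d l s : nat}.
Context (a : 'I_l.+1 -> R) (v : 'I_l.+1 -> 'rV[R]_d).
Context (b : 'I_s.+1 -> R) (w : 'I_s.+1 -> 'rV[R]_d).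
Implicit Types (x y : 'rV[R]_d) (i : 'I_l.+1) (j : 'I_s.+1).

Lemma f_lower_ge i x : a i + dotv (v i) x <= f_lower a v x.
Proof. exact: le_bigmax. Qed.

Lemma f_lower_attained x : exists i, f_lower a v x = a i + dotv (v i) x.
Proof.
rewrite /f_lower; elim/big_ind : _ => [|y z [i ->] [i' ->]|i _].
- by exists ord0.
- by case: leP => _; [exists i'|exists i].
- by exists i.
Qed.

Lemma f_upper_le j x : f_upper b w x <= b j + dotv (w j) x.
Proof. exact: bigmin_le. Qed.

Lemma f_upper_attained x : exists j, f_upper b w x = b j + dotv (w j) x.
Proof.
rewrite /f_upper; elim/big_ind : _ => [|y z [j ->] [j' ->]|j _].
- by exists ord0.
- by case: leP => _; [exists j|exists j'].
- by exists j.
Qed.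

Definition branch j y : R := f_lower a v y + (b j + dotv (w j) y).

Definition branch_piece j : 'I_l.+1 -> 'rV[R]_d -> R :=
  piece (fun i => a i + b j) (fun i => v i + w j).

Lemma branch_pieceE j i y :
  branch_piece j i y = (a i + dotv (v i) y) + (b j + dotv (w j) y).
Proof. by rewrite /branch_piece /piece dotvDl addrACA. Qed.

Lemma branch_ge j i y : branch_piece j i y <= branch j y.
Proof. by rewrite branch_pieceE lerD2r f_lower_ge. Qed.

Lemma branch_attained j y : exists i, branch j y = branch_piece j i y.
Proof.
have [i iE] := f_lower_attained y; exists i.
by rewrite branch_pieceE -iE.
Qed.

(** The points of the shifted hypodifferential have first coordinates relative to
    [f_lower x + f_upper x], that is, to the value of f rather than of the
    branch. *)
Lemma descent_ptE j x : descent_pt a v b w j x =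
  nearest (fun i => a i + b j) (fun i => v i + w j)
    (f_lower a v x + f_upper b w x) x.
Proof.
rewrite /descent_pt /nearest /hypodiff co_range; congr min_norm_point.
have hypoE : hypopoint (fun i => a i + b j) (fun i => v i + w j)
    (f_lower a v x + f_upper b w x) x =
    (fun i => ((a i - f_lower a v x + dotv (v i) x : R^o), v i) +
              zpt b w j x).
  apply/funext => i; congr pair.
  by rewrite /piece dotvDl /=; ring.
apply/seteqP; split => [_ [_ [t wt <-] <-]|_ [t wt <-]].
  by exists t => //; rewrite hypoE (comb_shift [set: 'I_l.+1]%SET).
rewrite hypoE (comb_shift [set: 'I_l.+1]%SET)//.
by eexists; [exists t|].
Qed.

End Representation.

(** * Exact line search *)

Section LineSearch.
Context {R : realType}.

(** The functions t |-> f (x - t *: u) belong to this class, which is closed under sums, maxima and minima and suffices for the existence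
    of minimizers on [0, +oo[. *)
Definition tame (g : R -> R) : Prop :=
  continuous g /\ exists T c m, forall t, T <= t -> g t = c + m * t.

Lemma tame_affine (c m : R) : tame (fun t => c + m * t).
Proof.
split; last by exists 0, c, m.
move=> t; apply: cvgD; first exact: cvg_cst.
by apply: cvgM; [exact: cvg_cst|exact: cvg_id].
Qed.

Lemma tameD g h : tame g -> tame h -> tame (fun t => g t + h t).
Proof.
move=> [cg [T1 [c1 [m1 gE]]]] [ch [T2 [c2 [m2 hE]]]]; split.
  by move=> t; apply: cvgD; [exact: cg|exact: ch].
exists (Num.max T1 T2), (c1 + c2), (m1 + m2) => t.
by rewrite ge_max => /andP[/gE -> /hE ->]; rewrite mulrDl addrACA.
Qed.

Lemma affine_eventually_le (c1 m1 c2 m2 : R) : exists T : R,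
  (forall t, T <= t -> c1 + m1 * t <= c2 + m2 * t) \/
  (forall t, T <= t -> c2 + m2 * t <= c1 + m1 * t).
Proof.
wlog m12 : c1 m1 c2 m2 / m1 <= m2.
  move=> wl; have [/wl//|/ltW/wl] := leP m1 m2.
  by move=> /(_ c2 c1) [T [?|?]]; exists T; [right|left].
have [m_eq|m_neq] := eqVneq m1 m2.
  exists 0; rewrite m_eq; have [c12|/ltW c21] := leP c1 c2.
    by left => t _; rewrite lerD2r.
  by right => t _; rewrite lerD2r.
exists ((c1 - c2) / (m2 - m1)); left => t.
by rewrite ler_pdivrMr ?subr_gt0 ?lt_neqAle ?m_neq//; lra.
Qed.

Lemma tame_max g h : tame g -> tame h -> tame (fun t => Num.max (g t) (h t)).
Proof.
move=> [cg [T1 [c1 [m1 gE]]]] [ch [T2 [c2 [m2 hE]]]]; split.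
  by move=> t; apply: (@continuous_max R R g h); [exact: cg|exact: ch].
have [T [le12|le21]] := affine_eventually_le c1 m1 c2 m2.
- exists (Num.max T (Num.max T1 T2)), c2, m2 => t.
  rewrite !ge_max => /and3P[/le12 tT /gE -> /hE ->].
  by rewrite max_r.
- exists (Num.max T (Num.max T1 T2)), c1, m1 => t.
  rewrite !ge_max => /and3P[/le21 tT /gE -> /hE ->].
  by rewrite max_l.
Qed.

Lemma tame_min g h : tame g -> tame h -> tame (fun t => Num.min (g t) (h t)).
Proof.
move=> [cg [T1 [c1 [m1 gE]]]] [ch [T2 [c2 [m2 hE]]]]; split.
  by move=> t; apply: (@continuous_min R R g h); [exact: cg|exact: ch].
have [T [le12|le21]] := affine_eventually_le c1 m1 c2 m2.
- exists (Num.max T (Num.max T1 T2)), c1, m1 => t.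
  rewrite !ge_max => /and3P[/le12 tT /gE -> /hE ->].
  by rewrite min_l.
- exists (Num.max T (Num.max T1 T2)), c2, m2 => t.
  rewrite !ge_max => /and3P[/le21 tT /gE -> /hE ->].
  by rewrite min_r.
Qed.

Lemma tame_big {I : Type} (r : seq I) (op : R -> R -> R) (F : I -> R -> R) g :
  (forall h k, tame h -> tame k -> tame (fun t => op (h t) (k t))) ->
  tame g -> (forall i, tame (F i)) ->
  tame (fun t => \big[op/g t]_(i <- r) F i t).
Proof.
move=> top tg tF; elim: r => [|i r IH].
  by under eq_fun => t do [rewrite big_nil].
under eq_fun => t do rewrite big_cons.
exact: top.
Qed.

(** The slope at infinity is nonnegative because [g] is bounded below, so the
    minimum is attained on a compact interval. *)
Lemma tame_argmin g L : tame g -> (forall t, L <= g t) ->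
  exists2 t, 0 <= t & forall t', 0 <= t' -> g t <= g t'.
Proof.
move=> [cg [T0 [c [m gE]]]] gL.
pose T := Num.max T0 0.
have T0' : 0 <= T by rewrite le_max lexx orbT.
have gT t : T <= t -> g t = c + m * t.
  by move=> Tt; apply: gE; apply: le_trans Tt; rewrite le_max lexx.
have m0 : 0 <= m.
  rewrite leNgt; apply/negP => m0.
  pose K := `|g T - L| + 1; pose t := T + K / - m.
  have := gL t; rewrite leNgt => /negP; apply.
  have Tt : T <= t by rewrite lerDl divr_ge0 ?addr_ge0// oppr_ge0 ltW.
  have -> : g t = g T - K.
    rewrite !gT// /t mulrDr addrA; congr (_ + _).
    by rewrite mulrCA invrN mulrN divff ?lt_eqF// mulrN1.
  by have := ler_norm (g T - L); rewrite /K; lra.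
have [|t] := @EVT_min R g 0 T T0'.
  exact: continuous_subspaceT.
rewrite in_itv/= => /andP[t0 tT] tmin; exists t => // t' t'0.
have [t'T|/ltW Tt'] := leP t' T; first by apply: tmin; rewrite in_itv/= t'0.
apply: (@le_trans _ _ (g T)); first by apply: tmin; rewrite in_itv/= T0' lexx.
by rewrite !gT// lerD2l ler_wpM2l.
Qed.

End LineSearch.

(** * Finite termination *)

Section Descent.
Context {R : realType} {d l s : nat}.
Context (a : 'I_l.+1 -> R) (v : 'I_l.+1 -> 'rV[R]_d).
Context (b : 'I_s.+1 -> R) (w : 'I_s.+1 -> 'rV[R]_d).
Context (f : 'rV[R]_d -> R) (bounded : has_lbound (range f)).
Context (fE : forall x, f x = f_lower a v x + f_upper b w x).

Lemma f_le_branch j y : f y <= branch a v b w j y.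
Proof. by rewrite fE lerD2l f_upper_le. Qed.

Lemma f_attained y : exists j, f y = branch a v b w j y.
Proof. by have [j jE] := f_upper_attained b w y; exists j; rewrite fE jE. Qed.

(** The witness is a branch of least infimum.  Its minimality is expressed by lower
    bounds because the step dichotomy proves minimality of a point by comparison
    with values, without reference to the infimum. *)
Lemma lowest_branch : exists j, forall C,
  (forall y, C <= branch a v b w j y) -> forall y, C <= f y.
Proof.
have [L Lf] := bounded.
pose m j := inf (range (branch a v b w j)).
exists [arg min_(j < ord0) m j]%O.
case: arg_minP => // j _ jmin C Cj y.
have [k ->] := f_attained y.
have Cm : C <= m j.
  apply: lb_le_inf; last by move=> _ [z _ <-].
  by exists (branch a v b w j 0); exists 0.
apply: (le_trans Cm); apply: (le_trans (jmin k isT)).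
apply: ge_inf; last by exists y.
exists L => _ [z _ <-]; apply: le_trans (f_le_branch k z).
by apply: Lf; exists z.
Qed.

(** Only the step associated with a branch of least infimum is considered: at a
    point that is not a global minimum it is available, and by the dichotomy it
    decreases f by a fixed amount or minimizes the branch, hence f. *)
Lemma descent_drop : exists2 e : R, 0 < e & forall x x',
  (forall j, descent_a a v b w j x < 0 ->
     f x' <= f (x + (1 / descent_a a v b w j x) *: descent_v a v b w j x)) ->
  [\/ is_global_min f x, is_global_min f x' | f x' <= f x - e].
Proof.
have [L Lf] := bounded.
have [j lowj] := lowest_branch.
have [e e0 dich] := nearest_step_dichotomy (fun i => a i + b j)
  (fun i => v i + w j).
exists e => // x x' x'_le.
have [|/existsNP[y /negP fyx]] := pselect (is_global_min f x).
  by apply: Or31.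
rewrite -ltNge in fyx.
have [z zx] : exists z, branch a v b w j z < f x.
  apply: contrapT => /forallNP xj.
  have /lowj/(_ y) : forall z, f x <= branch a v b w j z.
    by move=> z; rewrite leNgt; exact/negP/xj.
  by rewrite leNgt fyx.
have al0 : (nearest (fun i => a i + b j) (fun i => v i + w j) (f x) x).1 < 0.
  apply: (@nearest_fst_lt0 _ _ _ _ _ _ L _ z) => [u|i].
    have [i iE] := branch_attained a v b w j u; exists i.
    rewrite -[leRHS]iE; apply: le_trans (f_le_branch j u).
    by apply: Lf; exists u.
  by apply: le_lt_trans zx; exact: branch_ge.
move/(_ j): x'_le; rewrite /descent_a /descent_v descent_ptE -fE => /(_ al0).
have := dich _ _ al0; set p := x + _ => /= px x'p.
have [i pE] := branch_attained a v b w j p.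
have x'i := le_trans x'p (f_le_branch j p); rewrite pE in x'i.
case: px => [drop|low].
  by apply: Or33; exact: le_trans x'i (drop i).
apply: Or32; apply: lowj => u; apply: (le_trans x'i).
by apply: low => k; exact: branch_ge.
Qed.

(** If no iterate were a global minimum, f would decrease by at least [e] at every
    iteration, against its lower bound. *)
Lemma descent_finite (x : nat -> 'rV[R]_d) :
  (forall n j, descent_a a v b w j (x n) < 0 -> f (x n.+1) <=
     f (x n + (1 / descent_a a v b w j (x n)) *: descent_v a v b w j (x n))) ->
  exists n, is_global_min f (x n).
Proof.
move=> xP; have [e e0 drop] := descent_drop; have [L Lf] := bounded.
apply: contrapT => /forallNP noMin.
have linear n : f (x n) <= f (x 0%N) - n%:R * e.
  elim: n => [|n IH]; first by rewrite mul0r subr0.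
  have [/noMin//|/noMin//|le_e] := drop _ _ (xP n).
  by apply: (le_trans le_e); rewrite -natr1 mulrDl mul1r; lra.
pose N := Num.truncn (`|f (x 0%N) - L| / e).
have := linear N.+1; have : L <= f (x N.+1) by apply: Lf; exists (x N.+1).
have : `|f (x 0%N) - L| < N.+1%:R * e.
  by rewrite -ltr_pdivrMr// truncnS_gt.
by have := ler_norm (f (x 0%N) - L); lra.
Qed.

Lemma line_search_exists x u : exists t, line_search_solution f x u t.
Proof.
have [L Lf] := bounded.
have tame_aff (c : R) q : tame (fun t => c + dotv q (x - t *: u)).
  under eq_fun => t do
    rewrite -scaleNr dotvDr dotvZr mulNr mulrC -mulNr mulrC addrA.
  under eq_fun => t do rewrite mulrC.
  exact: tame_affine.
have tf : tame (fun t => f (x - t *: u)).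
  under eq_fun => t do rewrite fE.
  apply: tameD.
    by apply: tame_big => //; exact: tame_max.
  by apply: tame_big => //; exact: tame_min.
have [|t t0 tmin] := tame_argmin _ L tf.
  by move=> t; apply: Lf; exists (x - t *: u).
by exists t.
Qed.

Lemma MCD_run_exists x0 : exists x alpha jn, MCD_run a v b w f x0 x alpha jn.
Proof.
have /choice[al alP] x : exists al : 'I_s.+1 -> R, forall j,
    line_search_solution f x (descent_v a v b w j x) (al j).
  have [al alP] := choice (fun j => line_search_exists x (descent_v a v b w j x)).
  by exists al.
pose g x j := f (x - al x j *: descent_v a v b w j x).
pose jn x := [arg min_(j < ord0) g x j]%O.
pose step x := x - al x (jn x) *: descent_v a v b w (jn x) x.
exists (fun n => iter n step x0), (fun n => al (iter n step x0)),
  (fun n => jn (iter n step x0)); split => // n; split => // j.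
by rewrite -/(g _ j) -/(g _ (jn _)) /jn; case: arg_minP => // k _; apply.
Qed.

(** The line search competes with the step size [- 1 / a_j], which is positive when
    a_j < 0. *)
Lemma MCD_run_finite x0 x alpha jn :
  MCD_run a v b w f x0 x alpha jn -> exists n, is_global_min f (x n).
Proof.
move=> [_ run]; apply: descent_finite => n j al0.
have [ls best xE] := run n.
rewrite xE; apply: (le_trans (best j)).
have [_ /(_ (- (1 / descent_a a v b w j (x n))))] := ls j.
rewrite scaleNr opprK; apply.
by rewrite oppr_ge0 div1r invr_le0 ltW.
Qed.

End Descent.

Theorem mainTheorem4 (R : realType) (d l s : nat)
    (a : 'I_l.+1 -> R) (v : 'I_l.+1 -> 'rV[R]_d)
    (b : 'I_s.+1 -> R) (w : 'I_s.+1 -> 'rV[R]_d)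
    (f : 'rV[R]_d -> R)
    (hpa : piecewise_affine f)
    (hbnd : has_lbound (range f))
    (hrep : forall x, f x = f_lower a v x + f_upper b w x) :
  (forall x : nat -> 'rV[R]_d,
     (forall n : nat,
        f (x n.+1) <= f (x n) /\
        forall j : 'I_s.+1, descent_a a v b w j (x n) < 0 ->
          f (x n.+1) <= f (x n + (1 / descent_a a v b w j (x n)) *:
                                   descent_v a v b w j (x n))) ->
     (exists y, is_global_min f y) /\ (exists n : nat, is_global_min f (x n)))
  /\
  (forall x0 : 'rV[R]_d,
     (exists x alpha jn, MCD_run a v b w f x0 x alpha jn) /\
     (forall x alpha jn, MCD_run a v b w f x0 x alpha jn ->
        exists n : nat, is_global_min f (x n))).
Proof.
split=> [x xP|x0].
  have [n xn] : exists n, is_global_min f (x n).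
    by apply: (descent_finite a v b w) => // n j; apply: (xP n).2.
  by split; [exists (x n)|exists n].
split; first exact: MCD_run_exists.
by move=> x alpha jn; exact: MCD_run_finite.
Qed.
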